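(* Let $F$ be a free semilattice. Then every consistent system of $F$-equations (in finitely many variables) is equivalent over $F$ to some finite subsystem of itself. In other words, $F$ has the Noetherian property for consistent systems (NPC).
   Context: A semilattice is a commutative idempotent semigroup. $F$ denotes the free semilattice with free generators $\{a_i \mid i\in I\}$: its elements are the finite nonempty products of distinct generators (equivalently, finite nonempty subsets of $I$ under union; there is no identity element). For a finite set of variables $X=\{x_1,\dots,x_n\}$ let $F(X)$ be the free semilattice on $X$. An $F$-term is an element of the free product (in the class of semilattices) $F\ast F(X)$, i.e. an expression $w(X)a$, $w(X)$ or $a$ with $w(X)\in F(X)$, $a\in F$. An $F$-equation is a formal equality $\tau(X)=\sigma(X)$ of two $F$-terms. A system is an arbitrary (possibly infinite) set of $F$-equations in a fixed finite set of variables; its solution set in $F^n$ is the intersection of the solution sets of its equations. A system is consistent if its solution set is nonempty. Two systems are equivalent over $F$ if they have the same solution set in $F^n$. A semilattice $L$ has NPC if every consistent system of $L$-equations is equivalent over $L$ to a finite subsystem (finite subset) of itself. *)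

(* Defs.v *)
From HB Require Import structures.
From mathcomp Require Import all_boot finmap.
From mathcomp Require Import boolp classical_sets functions cardinality.

Set Implicit Arguments.
Unset Strict Implicit.
Unset Printing Implicit Defensive.

Local Open Scope classical_set_scope.
Local Open Scope fset_scope.
Local Open Scope group_scope.

HB.mixin Record Semigroup_isSemilattice L of Semigroup L := {
  semilatticeC : commutative (@mul L);
  semilatticexx : idempotent_op (@mul L)
}.

#[short(type="semilatticeType")]
HB.structure Definition Semilattice :=
  {L of Semigroup_isSemilattice L & Semigroup L}.

Definition free_semilattice (I : choiceType) : Type :=
  {A : {fset I} | A != fset0}.

HB.instance Definition _ (I : choiceType) :=
  SubChoice.on (free_semilattice I).

Lemma fsetU_neq0 (I : choiceType) (A B : free_semilattice I) :
  val A `|` val B != fset0.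
Proof. by rewrite fsetU_eq0 (negPf (valP A)). Qed.

Definition free_mul (I : choiceType) (A B : free_semilattice I) :
    free_semilattice I :=
  Sub (val A `|` val B) (fsetU_neq0 A B).

Lemma free_mulA (I : choiceType) : associative (@free_mul I).
Proof. by move=> A B C; apply: val_inj; rewrite /= fsetUA. Qed.

HB.instance Definition _ (I : choiceType) :=
  isSemigroup.Build (free_semilattice I) (@free_mulA I).

Lemma free_mulC (I : choiceType) : commutative (@free_mul I).
Proof. by move=> A B; apply: val_inj; rewrite /= fsetUC. Qed.

Lemma free_mulxx (I : choiceType) : idempotent_op (@free_mul I).
Proof. by move=> A; apply: val_inj; rewrite /= fsetUid. Qed.

HB.instance Definition _ (I : choiceType) :=
  Semigroup_isSemilattice.Build (free_semilattice I)
    (@free_mulC I) (@free_mulxx I).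

Lemma fset1_neq0 (I : choiceType) (i : I) : [fset i] != fset0.
Proof. by apply/fset0Pn; exists i; rewrite in_fset1. Qed.

Definition free_gen (I : choiceType) (i : I) : free_semilattice I :=
  Sub [fset i] (fset1_neq0 i).

(* The product of f over the nonempty set w. A semilattice need not have an   *)
(* identity to start the product from, so it starts from f j for some j in w; *)
(* the repeated factor f j is harmless by idempotence.                        *)
Definition free_ext (I : choiceType) (L : semilatticeType) (f : I -> L)
    (w : free_semilattice I) : L :=
  foldr (fun i y => f i * y) (f (xchoose (fset0Pn _ (valP w)))) (val w).

(* free_ext f is the unique semilattice morphism extending f *)
Lemma foldr_in (I : choiceType) (L : semilatticeType) (f : I -> L)
    (s : seq I) (b : L) (k : I) :
  k \in s -> f k * foldr (fun i y => f i * y) b s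
             = foldr (fun i y => f i * y) b s.
Proof.
elim: s => //= i s IHs; rewrite inE => /orP[/eqP ->|/IHs e].
  by rewrite mulgA semilatticexx.
by rewrite mulgA (semilatticeC (f k)) -mulgA e.
Qed.

Lemma foldr_absorb (I : choiceType) (L : semilatticeType) (f : I -> L)
    (s : seq I) (b y : L) :
  b * y = y -> (forall k, k \in s -> f k * y = y) ->
  foldr (fun i z => f i * z) b s * y = y.
Proof.
move=> by_ sy; elim: s sy => //= i s IHs sy.
rewrite -mulgA IHs ?sy ?mem_head // => k ks.
by apply: sy; rewrite inE ks orbT.
Qed.

Lemma free_ext_in (I : choiceType) (L : semilatticeType) (f : I -> L)
    (w : free_semilattice I) (k : I) :
  k \in val w -> f k * free_ext f w = free_ext f w.
Proof. exact: foldr_in. Qed.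

Lemma free_ext_absorb (I : choiceType) (L : semilatticeType) (f : I -> L)
    (w : free_semilattice I) (y : L) :
  (forall k, k \in val w -> f k * y = y) -> free_ext f w * y = y.
Proof. by move=> wy; apply: foldr_absorb => //; apply: wy; apply: xchooseP. Qed.

Lemma free_ext_gen (I : choiceType) (L : semilatticeType) (f : I -> L) (i : I) :
  free_ext f (free_gen i) = f i.
Proof.
have ii : i \in val (free_gen i) by rewrite in_fset1.
rewrite -[LHS](free_ext_in f ii) semilatticeC free_ext_absorb // => k.
by rewrite in_fset1 => /eqP ->; rewrite semilatticexx.
Qed.

Lemma free_extM (I : choiceType) (L : semilatticeType) (f : I -> L) :
  {morph free_ext f : v w / v * w}.
Proof.
move=> v w; set u := v * w.
have absorb k : k \in val u ->
    f k * (free_ext f v * free_ext f w) = free_ext f v * free_ext f w.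
  rewrite in_fsetU => /orP[kv|kw]; first by rewrite mulgA free_ext_in.
  by rewrite mulgA (semilatticeC (f k)) -mulgA free_ext_in.
rewrite -(free_ext_absorb absorb) semilatticeC -mulgA.
rewrite (@free_ext_absorb _ _ f w) ?(@free_ext_absorb _ _ f v) // => k kx;
  by apply: free_ext_in; rewrite in_fsetU kx ?orbT.
Qed.

Lemma free_ext_unique (I : choiceType) (L : semilatticeType) (f : I -> L)
    (g : free_semilattice I -> L) :
  {morph g : v w / v * w} -> (forall i, g (free_gen i) = f i) ->
  g =1 free_ext f.
Proof.
move=> gM gf w; rewrite /free_ext.
set j := xchoose _; have jw : j \in val w by apply: xchooseP.
have E s : {subset s <= val w} ->
    exists2 v : free_semilattice I, val v =i j :: s
      & g v = foldr (fun i y => f i * y) (f j) s.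
  elim: s => [_|i s IHs sw]; first by
    exists (free_gen j) => [k|//]; rewrite in_fset1 inE.
  have [k ks|v vs gv] := IHs; first by apply: sw; rewrite inE ks orbT.
  exists (free_gen i * v) => [k|]; last by rewrite gM gf gv.
  by rewrite in_fsetU in_fset1 vs !inE orbCA.
have [//|v vE <-] := E (enum_fset (val w)); congr g; apply/val_inj/fsetP => k.
by rewrite vE inE; case: eqP => [->|].
Qed.

(* L-terms in n variables: the elements of the free product L * F(X), where   *)
(* F(X) is the free semilattice on X = {x_0, ..., x_(n-1)}.                   *)
Inductive lterm (L : semilatticeType) (n : nat) : Type :=
| TVarConst of free_semilattice 'I_n & L
| TVar of free_semilattice 'I_n
| TConst of L.

Definition term_eval (L : semilatticeType) (n : nat) (p : {ffun 'I_n -> L})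
    (t : lterm L n) : L :=
  match t with
  | TVarConst w a => free_ext p w * a
  | TVar w => free_ext p w
  | TConst a => a
  end.

Definition equation (L : semilatticeType) (n : nat) : Type :=
  (lterm L n * lterm L n)%type.

Definition equation_sol (L : semilatticeType) (n : nat) (e : equation L n) :
    set {ffun 'I_n -> L} :=
  [set p | term_eval p e.1 = term_eval p e.2].

Definition system_sol (L : semilatticeType) (n : nat)
    (S : set (equation L n)) : set {ffun 'I_n -> L} :=
  \bigcap_(e in S) equation_sol e.

Definition consistent (L : semilatticeType) (n : nat)
    (S : set (equation L n)) : Prop :=
  system_sol S !=set0.

Definition equivalent (L : semilatticeType) (n : nat)
    (S1 S2 : set (equation L n)) : Prop :=
  system_sol S1 = system_sol S2.

(* The Noetherian property for consistent systems *)
Definition NPC (L : semilatticeType) : Prop :=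
  forall (n : nat) (S : set (equation L n)), consistent S ->
  exists S0 : set (equation L n),
    [/\ (S0 `<=` S)%classic, finite_set S0 & equivalent S S0].

(* Main.v *)
Require Import Defs.
From mathcomp Require Import all_boot.
From mathcomp Require Import finmap.
From mathcomp Require Import boolp classical_sets functions cardinality.

(** An equation over a free semilattice says that two unions of finite sets
    agree, so it holds at a point if and only if it holds at every generator
    separately ([equation_solP]).  At a generator [i], the condition that it
    puts on the point depends only on the variables occurring on the two sides
    and on whether [i] lies in the constant of each side.

    Let a consistent system be given, with a solution [q], and let [M] be the
    finite set of generators occurring in [q].  Outside [M] the two constants of
    every equation of the system coincide, since [q] solves it
    ([equation_sol_constants]).  Hence at [i] outside [M] an equation is either
    void, when [i] is in both constants, or else the homogeneous condition given
    by its variables alone.  There are finitely many pairs of sets of variables;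
    choose one equation of the system for each pair that occurs.  Only finitely
    many generators occur in the chosen equations; let [N] consist of those and
    of [M].  At every generator outside [N] the chosen equations impose all the
    homogeneous conditions, hence imply the whole system there.  Over [N] an
    equation is determined by its variables and by the traces of its constants
    on [N], which again leaves finitely many cases; choosing one equation for
    each of them takes care of the generators in [N].  Both choices are
    instances of [finite_representatives]. *)

Set Implicit Arguments.
Unset Strict Implicit.
Unset Printing Implicit Defensive.

Local Open Scope classical_set_scope.

(** The device that extracts a finite subsystem: when equations are classified
    by finitely many labels, one equation for each label that occurs is enough
    to witness all of them. *)
Lemma finite_representatives (T : Type) (K : finType) (f : T -> K)
    (S : set T) :
  exists S0 : set T, [/\ S0 `<=` S, finite_set S0 &
    forall e, S e -> exists2 e', S0 e' & f e' = f e].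
Proof.
have [->|/set0P[e0 Se0]] := eqVneq S set0.
  by exists set0; split=> // e [].
have rep_ex (k : K) : exists e, S e /\ forall e', S e' -> f e' = k -> f e = k.
  (* A label that does not occur in S gets the arbitrary element e0. *)
  have [[e Se fe]|noe] := pselect (exists2 e, S e & f e = k).
    by exists e; split=> [//|e' _ _].
  by exists e0; split=> // e' Se' fe'; case: noe; exists e'.
have [rep repP] := choice rep_ex.
exists (range rep); split=> [_ [k _ <-]| |e Se].
- by have [] := repP k.
- exact/finite_image/finite_finset.
- by exists (rep (f e)); [exists (f e)|exact: (repP (f e)).2 Se _].
Qed.

Lemma fset_cover (I : choiceType) (T : Type) (D : set T)
    (c : T -> {fset I}) :
  finite_set D ->
  exists N : {fset I}, forall i, i \notin N -> forall e, D e -> i \notin c e.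
Proof.
move=> fin_D; have /finite_fsetP[N defN] :
    finite_set (\bigcup_(e in D) [set` c e]).
  by apply: bigcup_finite => // e _; exact: finite_fset.
exists N => i niN e De; apply: contra niN => ic.
suff : [set` N] i by [].
by rewrite -defN; exists e.
Qed.

Section FreeSemilatticeEquations.
Variables (I : choiceType) (n : nat).
Local Notation F := (free_semilattice I).
Implicit Types (p : {ffun 'I_n -> F}) (t : lterm F n) (e : equation F n).

(** A term is split into its variables and its constant; a missing part becomes
    the empty set, which is the neutral element for union that [F] itself
    does not contain. *)
Definition term_vars t : {set 'I_n} :=
  match t with
  | TVarConst w _ | TVar w => [set j in val w]
  | TConst _ => finset.set0
  end.

Definition term_const t : {fset I} :=
  match t with
  | TVarConst _ a | TConst a => val a
  | TVar _ => fset0%fset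
  end.

Definition equation_vars e := (term_vars e.1, term_vars e.2).

Definition equation_const e : {fset I} :=
  (term_const e.1 `|` term_const e.2)%fset.

Definition covered p (W : {set 'I_n}) (i : I) :=
  [exists j in W, i \in val (p j)].

(** Products in [F] are unions, so a generator divides a product of variables if
    and only if it divides the value of one of them. *)
Lemma mem_free_ext p (w : free_semilattice 'I_n) (i : I) :
  (i \in val (free_ext p w)) = covered p [set j in val w] i.
Proof.
rewrite /free_ext; set j0 := xchoose _.
have j0w : j0 \in val w by apply: xchooseP.
(* The fold starts from the value at j0, which counts as one more factor. *)
have -> (s : seq 'I_n) : (i \in val (foldr (fun j y => p j * y)%g (p j0) s)) =
    has (fun j => i \in val (p j)) (rcons s j0).
  by elim: s => /= [|j s IHs]; [rewrite orbF|rewrite in_fsetU IHs].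
apply/hasP/exists_inP => -[j]; last first.
  by rewrite inE => jw ij; exists j; rewrite // mem_rcons inE jw orbT.
rewrite mem_rcons inE => jw ij; exists j; rewrite // inE.
by case/predU1P: jw => [->|].
Qed.

Lemma mem_term_eval p t (i : I) :
  (i \in val (term_eval p t)) =
  covered p (term_vars t) i || (i \in term_const t).
Proof.
case: t => [w a|w|a] /=.
- by rewrite in_fsetU mem_free_ext.
- by rewrite mem_free_ext orbF.
- by rewrite [covered _ _ _](introF exists_inP) // => -[j]; rewrite inE.
Qed.

(** Written through [covered] rather than as equality of the two values at [i],
    to show that the constants enter only through membership of [i]. *)
Definition holds_at p (i : I) e :=
  covered p (term_vars e.1) i || (i \in term_const e.1) =
  covered p (term_vars e.2) i || (i \in term_const e.2).

Lemma equation_solP p e : equation_sol e p <-> forall i, holds_at p i e.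
Proof.
split=> [ep i|ep]; first by rewrite /holds_at -!mem_term_eval [in LHS]ep.
by apply/val_inj/fsetP => i; rewrite !mem_term_eval; exact: ep.
Qed.

(** At a generator absent from a solution only the constants contribute, so they
    must agree there.  This is where consistency of the system enters. *)
Lemma equation_sol_constants p e (i : I) :
  equation_sol e p -> (forall j, i \notin val (p j)) ->
  (i \in term_const e.1) = (i \in term_const e.2).
Proof.
move=> /equation_solP/(_ i) + ip; rewrite /holds_at.
have uncov W : covered p W i = false.
  by apply/exists_inP => -[j _]; rewrite (negPf (ip j)).
by rewrite !uncov.
Qed.

(** Since [i] is in no constant of [e'], this equation imposes at [i] its
    homogeneous part, which is also that of [e]; and [e] asks for nothing more
    at [i], as its two constants agree there: if both contain [i], it asks for
    nothing at all. *)
Lemma holds_at_homogeneous p (i : I) e e' :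
  equation_vars e' = equation_vars e -> i \notin equation_const e' ->
  (i \in term_const e.1) = (i \in term_const e.2) ->
  holds_at p i e' -> holds_at p i e.
Proof.
move=> [W1 W2]; rewrite in_fsetU negb_or => /andP[/negPf ni1 /negPf ni2] ee.
by rewrite /holds_at ni1 ni2 !orbF W1 W2 ee => ->.
Qed.

(** The constants are cut down to [N] and recorded as subsets of the finite type
    [N], so that only finitely many traces exist. *)
Definition equation_trace (N : {fset I}) e : {set N} * {set N} :=
  ([set x : N | fsval x \in term_const e.1]%SET,
   [set x : N | fsval x \in term_const e.2]%SET).

Lemma holds_at_trace (N : {fset I}) p (i : I) e e' :
  i \in N -> equation_vars e' = equation_vars e ->
  equation_trace N e' = equation_trace N e ->
  holds_at p i e' -> holds_at p i e.
Proof.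
move=> iN [W1 W2] [/setP/(_ [` iN]%fset) c1 /setP/(_ [` iN]%fset) c2].
by move: c1 c2; rewrite /holds_at !inE /= W1 W2 => -> ->.
Qed.

End FreeSemilatticeEquations.

Theorem theorem3p3 (I : choiceType) : NPC (free_semilattice I).
Proof.
move=> n S [q Sq].
have [S1 [S1S fin_S1 S1_vars]] := finite_representatives (@equation_vars I n) S.
have [N1 N1_const] := fset_cover (@equation_const I n) fin_S1.
have [M M_sol] :=
  fset_cover (fun j => val (q j)) (@finite_finset _ [set: 'I_n]).
pose N := (M `|` N1)%fset.
have [S2 [S2S fin_S2 S2_trace]] := finite_representatives
  (fun e : equation _ n => (equation_vars e, equation_trace N e)) S.
exists (S1 `|` S2); split.
- by move=> e [/S1S|/S2S].
- by rewrite finite_setU.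
apply/seteqP; split=> [p Sp e [/S1S|/S2S]|p S12p e Se]; try exact: Sp.
apply/equation_solP => i; have [iN|] := boolP (i \in N).
  have [e' S2e' [W1 W2 c1 c2]] := S2_trace e Se.
  apply: (@holds_at_trace _ _ N _ _ _ e') => //; try by congr pair.
  by have /equation_solP : equation_sol e' p by apply: S12p; right.
rewrite in_fsetU negb_or => /andP[niM niN1].
(* N1 was chosen so that no constant of an equation of S1 leaves it. *)
have [e' S1e' vars_e'] := S1_vars e Se.
apply: (holds_at_homogeneous vars_e').
- exact: N1_const.
- by apply: equation_sol_constants (Sq e Se) _ => j; exact: M_sol.
- by have /equation_solP : equation_sol e' p by apply: S12p; left.
Qed.
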